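(* Let $\gamma\ge0$, $\alpha>0$, $\mu\in\mathbb{R}$ with $\delta:=\alpha(\mu+1)-\gamma>0$, and $g(x):=x^{\gamma}(x^\alpha+1)^{-\mu-1}$. Then $g$ is of bounded variation on $[0,+\infty)$, with total variation $V_0^\infty(g)=1$ if $\gamma=0$ and $$V_0^\infty(g)=2\left(\frac{\gamma}{\delta}\right)^{\frac{\gamma}{\alpha}}\left(\frac{\gamma}{\delta}+1\right)^{-\mu-1}\quad\text{if }\gamma>0.$$ Furthermore, for every $u\ge0$ and $t>0$, $$\tilde S(t,u,\gamma,\alpha,\mu)=\frac{g(0)+l(t,u)}{t^{\alpha(\mu+1)-\gamma}},\quad\text{where }|l(t,u)|\le V_0^\infty(g)\text{ and }l(t,u)=o(1)\text{ as }t\to+\infty.$$ If, in addition, $\delta>1$, then for every $u\ge0$ and $t>0$, $$S(t,u,\gamma,\alpha,\mu)=\frac{\frac{2}{\alpha}\,B\left(\frac{\gamma+1}{\alpha},\mu+1-\frac{\gamma+1}{\alpha}\right)}{t^{\alpha(\mu+1)-\gamma-1}}-\frac{(1+2u)\,g(0)-L(t,u)}{t^{\alpha(\mu+1)-\gamma}},$$ where $|L(t,u)|\le(1+2u)V_0^\infty(g)$ and $L(t,u)=o(1)$ as $t\to+\infty$. In both cases the $o(1)$ is uniform in $u\in[0,a]$ for every fixed $a>0$.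
   Context: $B(\cdot,\cdot)$ is the Euler Beta function; $x^0=1$ including at $x=0$ (so $g(0)=1$ if $\gamma=0$ and $g(0)=0$ if $\gamma>0$). The generalized Mathieu series are, for $u>-1$, $t\ge0$, $$S(t,u,\gamma,\alpha,\mu):=\sum_{k=1}^{\infty}\frac{2(k+u)^{\gamma}}{((k+u)^{\alpha}+t^{\alpha})^{\mu+1}}\ (\delta>1),\qquad \tilde S(t,u,\gamma,\alpha,\mu):=\sum_{k=1}^{\infty}\frac{2(-1)^{k-1}(k+u)^{\gamma}}{((k+u)^{\alpha}+t^{\alpha})^{\mu+1}}\ (\delta>0).$$ *)

(* Defs.v *)
From HB Require Import structures.
From mathcomp Require Import all_boot all_order all_algebra.
From mathcomp Require Import all_classical all_reals all_analysis.

Set Implicit Arguments.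
Unset Strict Implicit.
Unset Printing Implicit Defensive.

Import Order.TTheory GRing.Theory Num.Theory.
Import numFieldNormedType.Exports.

Local Open Scope classical_set_scope.
Local Open Scope ring_scope.

(* Real powers are [powR]; it satisfies [0 `^ 0 = 1] and [0 `^ x = 0] for
   [x != 0], which is exactly the convention x^0 = 1 (including at x = 0). *)

Definition mathieu_term (R : realType) (t u gamma alpha mu : R) (k : nat) : R :=
  2 * (k%:R + u) `^ gamma
    / ((k%:R + u) `^ alpha + t `^ alpha) `^ (mu + 1).

Definition mathieu_psum (R : realType) (t u gamma alpha mu : R) (n : nat) : R :=
  \sum_(1 <= k < n.+1) mathieu_term t u gamma alpha mu k.

Definition alt_mathieu_psum (R : realType) (t u gamma alpha mu : R)
    (n : nat) : R :=
  \sum_(1 <= k < n.+1) (-1) ^+ k.-1 * mathieu_term t u gamma alpha mu k.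

(* [limn] is total: the values below are meaningful when the partial sums
   converge. *)
Definition mathieu (R : realType) (t u gamma alpha mu : R) : R :=
  limn (mathieu_psum t u gamma alpha mu).

Definition alt_mathieu (R : realType) (t u gamma alpha mu : R) : R :=
  limn (alt_mathieu_psum t u gamma alpha mu).

(* The library's [beta_fun] only takes natural number parameters.
   Meaningful for 0 < x and 0 < y. *)
Definition euler_beta (R : realType) (x y : R) : R :=
  \int[@lebesgue_measure R]_(s in `]0, 1[) (s `^ (x - 1) * (1 - s) `^ (y - 1)).

(* All finite partitions of all the intervals [a, b] with a <= b. *)
Definition ray_variations (R : realType) (a : R) (f : R -> R) : set R :=
  \bigcup_(b in `[a, +oo[) variations a b f.

Definition ray_bounded_variation (R : realType) (a : R) (f : R -> R) : Prop :=
  has_ubound (ray_variations a f).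

Definition ray_total_variation (R : realType) (a : R) (f : R -> R) : \bar R :=
  ereal_sup [set x%:E | x in ray_variations a f].

Definition mathieu_g (R : realType) (gamma alpha mu x : R) : R :=
  x `^ gamma * (x `^ alpha + 1) `^ (- mu - 1).

(* h(t, u) tends to 0 as t -> +oo, uniformly in u in the set A. *)
Definition unif_littleo1 (R : realType) (A : set R) (h : R -> R -> R) : Prop :=
  forall e : R, 0 < e -> \forall t \near +oo, forall u, A u -> `|h t u| <= e.

(* Main.v *)
Require Import Defs.
From HB Require Import structures.
From mathcomp Require Import all_boot all_order all_algebra.
From mathcomp Require Import all_classical all_reals all_analysis.
From mathcomp Require Import measurable_realfun ring lra.

Set Implicit Arguments.
Unset Strict Implicit.
Unset Printing Implicit Defensive.

Import Order.TTheory GRing.Theory Num.Theory.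
Import numFieldNormedType.Exports.

Local Open Scope classical_set_scope.
Local Open Scope ring_scope.

(** Write [h = 1/t].  By homogeneity the terms of both series are
    [2 t^(-delta) g((k+u)h)], so that everything is about the samples of one
    function [g] at step [h].

    Variation.  The derivative of [g] has the sign of
    [gamma - delta x^alpha], so [g] increases up to its mode
    [m = (gamma/delta)^(1/alpha)] and then decreases to [0].  Its variation on
    the half-line is therefore [V = 2 g(m) - g(0)], and the variation on
    [[0, x]] is an explicit monotone function [W] going from [0] to [V]
    ([unimodal_ray_total_variation], [unimodal_variation_bound]).

    Remainders as sums of second differences.  With [a_k = g((k+u)h)], pairing
    the terms of the alternating sum gives
    [2 sum (-1)^(k-1) a_k = a_1 + sum_j (a_(2j-1) - 2 a_(2j) + a_(2j+1))];
    and for a primitive [F] of [g], the midpoint error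
    [2 r g(c) - (F(c+r) - F(c-r))] is controlled, through the mean value
    theorem, by a second difference [g(c+s) + g(c-s) - 2 g(c)] with [s <= r].
    In both cases the second differences live on cells [[c-r, c+r]] that do not
    overlap.  Hence, if each of them is at most the increment of a monotone
    function [W'] over its cell ([second_diff_bound g W' r]), the remainder
    telescopes and is at most the total increment of [W'].

    The same telescoping is used twice.  With [W' = W] it gives the bounds by
    [V] and [(1+2u)V], the part of the variation located before the first cell
    paying for the difference between [g] and [g(0)] there.  For the [o(1)],
    [second_diff_bound_small] produces, for small [r], a [W'] of total increment
    at most [e]: near [0] and near [+oo] the function [W] varies little, and in
    between [g] is continuously differentiable, so a second difference is [o(r)]
    uniformly.  The parameter [u] matters only for the part before the first
    cell, which tends to [0] uniformly for [u] in [[0, a]].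

    The constant.  When [delta > 1], [g] is integrable, and the substitution
    [x = (s/(1-s))^(1/alpha)] turns [alpha] times its integral into the Beta
    integral ([euler_beta_mathieu_integral]). *)


(** * Majorants of second differences *)

Definition variation_bound (R : realType) (g W : R -> R) :=
  forall x y, 0 <= x -> x <= y -> `|g y - g x| <= W y - W x.

(** The bound is by the increment of [W] over the whole cell [[c - r, c + r]]
    even when [s < r]: summed over adjacent cells it telescopes. *)
Definition second_diff_bound (R : realType) (g W : R -> R) (r : R) :=
  forall c s, 0 <= s -> s <= r -> r <= c ->
    `|g (c + s) + g (c - s) - 2 * g c| <= W (c + r) - W (c - r).

Lemma variation_bound_homo (R : realType) (g W : R -> R) x y :
  variation_bound g W -> 0 <= x -> x <= y -> W x <= W y.
Proof. by move=> gW x0 xy; rewrite -subr_ge0 (le_trans _ (gW _ _ x0 xy)). Qed.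

Lemma variation_second_diff_bound (R : realType) (g W : R -> R) (r : R) :
  variation_bound g W -> second_diff_bound g W r.
Proof.
move=> gW c s s0 sr rc.
have c0 : 0 <= c - s by lra.
have -> : g (c + s) + g (c - s) - 2 * g c =
  (g (c + s) - g c) - (g c - g (c - s)) by ring.
have h1 : `|g (c + s) - g c| <= W (c + s) - W c by apply: gW; lra.
have h2 : `|g c - g (c - s)| <= W c - W (c - s) by apply: gW; lra.
have h3 : W (c + s) <= W (c + r) by apply: (variation_bound_homo gW); lra.
have h4 : W (c - r) <= W (c - s) by apply: (variation_bound_homo gW); lra.
by apply: (le_trans (ler_normB _ _)); lra.
Qed.

(** By the mean value theorem the second difference at [c] is [s] times the
    difference of two values of [g'] near [c]; compactness of [[m, M]] makes
    the smallness of that difference uniform in [c]. *)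
Lemma second_diff_small (R : realType) (g g' : R -> R) (m M eta : R) :
  0 < m -> 0 < eta ->
  (forall x : R, 0 < x -> is_derive x 1 g (g' x)) ->
  (forall x : R, 0 < x -> {for x, continuous g'}) ->
  exists2 r0, 0 < r0 & forall c s, m <= c -> c <= M -> 0 <= s -> s <= r0 ->
    `|g (c + s) + g (c - s) - 2 * g c| <= eta * s.
Proof.
move=> m0 eta0 dg cg'.
have := @segment_compact R m M.
move=> /compact_near_coveringP/(_ R (nbhs 0)
  (fun s c => 0 <= s -> `|g (c + s) + g (c - s) - 2 * g c| <= eta * s)).
case.
  move=> c /=; rewrite in_itv/= => /andP[mc cM].
  have c0 : 0 < c by exact: lt_le_trans mc.
  have /cvgrPdist_le/(_ (eta / 2)) := cg' c c0.
  rewrite divr_gt0// => /(_ erefl) /nbhs_ballP[d /= d0 dP].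
  have e0 : 0 < Num.min d c / 2 by rewrite divr_gt0// lt_min d0.
  exists (ball c (Num.min d c / 2), ball 0 (Num.min d c / 2)) => /=.
    by split; exact: nbhsx_ballx.
  move=> [x s] /= []; rewrite /ball/= sub0r normrN => xc sc s0.
  have dmin : Num.min d c <= d by rewrite ge_min lexx.
  have cmin : Num.min d c <= c by rewrite ge_min lexx orbT.
  move: xc sc; rewrite (ger0_norm s0) ltr_norml => /andP[xc1 xc2] sc.
  have MV a b : a <= b -> x - s <= a -> b <= x + s ->
     exists2 z, `|g' c - g' z| <= eta / 2 & g b - g a = g' z * (b - a).
    move=> ab xa bx.
    have az z : z \in `[a, b]%R -> 0 < z /\ `|c - z| < d.
      by rewrite in_itv/= => /andP[az zb]; rewrite ltr_norml; split; lra.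
    have [||z zab ->] := @MVT_segment R g g' a b ab.
    - move=> z zab; apply: dg; apply: (az z _).1.
      by apply: subset_itv_oo_cc zab.
    - apply: derivable_within_continuous => z /az[z0 _].
      by case: (dg z z0).
    by exists z => //; apply: dP; rewrite /ball/=; apply: (az z zab).2.
  have [|||z1 z1c E1] := MV x (x + s); [lra..|].
  have [|||z2 z2c E2] := MV (x - s) x; [lra..|].
  have -> : g (x + s) + g (x - s) - 2 * g x =
    (g (x + s) - g x) - (g x - g (x - s)) by ring.
  rewrite E1 E2 (_ : _ - _ = (g' z1 - g' z2) * s); last by ring.
  rewrite normrM (ger0_norm s0).
  rewrite ler_wpM2r//.
  have -> : g' z1 - g' z2 = (g' c - g' z2) - (g' c - g' z1) by ring.
  by apply: (le_trans (ler_normB _ _)); lra.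
move=> d /= d0 dP; exists (d / 2); first by rewrite divr_gt0.
move=> c s mc cM s0 sd; apply: (dP s) => //=.
  by rewrite sub0r normrN ger0_norm//; lra.
by rewrite in_itv/= mc cM.
Qed.

(** The majorant [W'] follows [W] on [[0, m]] and beyond [M], where [W] varies
    little, and grows with the small slope [eta] up to [2 M], where
    [second_diff_small] applies.  A short cell lies in [[0, m]], beyond [M], or
    in the interior of [[m/2, 2 M]], and in each case one of the three summands
    dominates. *)
Lemma second_diff_bound_small (R : realType) (g g' W : R -> R) (V e : R) :
  variation_bound g W -> W 0 = 0 ->
  W x @[x --> 0^'+] --> 0 -> W x @[x --> +oo] --> V ->
  (forall x : R, 0 < x -> is_derive x 1 g (g' x)) ->
  (forall x : R, 0 < x -> {for x, continuous g'}) ->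
  0 < e -> exists2 W', (forall x, 0 <= x -> 0 <= W' x <= e) &
    exists2 r0, 0 < r0 & forall r, 0 < r -> r <= r0 ->
      second_diff_bound g W' r.
Proof.
move=> gW W0 Wz Wy dg cg' e0.
have Wle x y : 0 <= x -> x <= y -> W x <= W y := @variation_bound_homo _ _ _ _ _ gW.
have [m m0 Wm] : exists2 m, 0 < m & W m <= e / 3.
  have /cvgrPdist_le/(_ (e / 3)) := Wz; rewrite divr_gt0// => /(_ erefl) H.
  near (0 : R)^'+ => m.
  exists m; first by near: m; exact: nbhs_right_gt.
  have : `|0 - W m| <= e / 3 by near: m.
  by rewrite sub0r normrN; apply: le_trans; exact: ler_norm.
have [M mM WM] : exists2 M, m <= M & forall x, M <= x -> W x - W M <= e / 3.
  have /cvgrPdist_le/(_ (e / 6)) := Wy; rewrite divr_gt0// => /(_ erefl).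
  case=> N [_ HN]; exists (Num.max m (N + 1)); first by rewrite le_max lexx.
  move=> x; set M := Num.max _ _ => Mx.
  have NM : N < M by rewrite lt_max ltrDl ltr01 orbT.
  have /ler_normlP[_ h1] := HN _ NM.
  have /ler_normlP[h2 _] := HN _ (lt_le_trans NM Mx).
  lra.
have M0 : 0 < M by lra.
(* the slope for which [eta * 2 M] is the third of [e] left for the interior *)
pose eta := e / (6 * M).
have eta0 : 0 < eta by rewrite divr_gt0// mulr_gt0.
have [r1 r10 sr1] := @second_diff_small R g g' (m / 2) (2 * M) eta
  (divr_gt0 m0 (ltr0n _ 2)) eta0 dg cg'.
pose W1 x := W (Num.min x m).
pose W2 x := W (Num.max x M) - W M.
pose W3 x := eta * Num.min x (2 * M).
have W1le x y : 0 <= x -> x <= y -> W1 x <= W1 y.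
  move=> x0 xy; apply: Wle; first by rewrite le_min x0 ltW.
  by rewrite le_min !ge_min xy lexx orbT.
have W2le x y : 0 <= x -> x <= y -> W2 x <= W2 y.
  move=> x0 xy; rewrite lerD2r; apply: Wle; first by rewrite le_max x0.
  by rewrite ge_max !le_max xy lexx orbT.
have W3le x y : 0 <= x -> x <= y -> W3 x <= W3 y.
  move=> x0 xy; rewrite ler_wpM2l ?(ltW eta0)//.
  by rewrite le_min !ge_min xy lexx orbT.
exists (fun x => W1 x + W2 x + W3 x).
- move=> x x0.
  have h1 := W1le _ _ (lexx 0) x0; have h2 := W2le _ _ (lexx 0) x0.
  have h3 := W3le _ _ (lexx 0) x0.
  move: h1 h2 h3; rewrite {1}/W1 {1}/W2 {1}/W3 (min_l (ltW m0)) (max_r (ltW M0)).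
  rewrite W0 subrr min_l; last lra.
  rewrite mulr0 => h1 h2 h3; apply/andP; split; first lra.
  have k1 : W1 x <= e / 3.
    apply: le_trans Wm; apply: Wle; first by rewrite le_min x0 ltW.
    by rewrite ge_min lexx orbT.
  have k2 : W2 x <= e / 3 by apply: WM; rewrite le_max lexx orbT.
  have k3 : W3 x <= e / 3.
    rewrite (_ : e / 3 = eta * (2 * M)).
      by rewrite ler_wpM2l ?(ltW eta0)// ge_min lexx orbT.
    by rewrite /eta; field; rewrite gt_eqF.
  lra.
exists (Num.min r1 (m / 4)); first by rewrite lt_min r10 divr_gt0.
move=> r r0; rewrite le_min => /andP[rr1 rm] c s s0 sr rc.
have a0 : 0 <= c - r by lra.
have ab : c - r <= c + r by lra.
have := W1le _ _ a0 ab; have := W2le _ _ a0 ab; have := W3le _ _ a0 ab.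
move=> h3 h2 h1.
have gWr := @variation_second_diff_bound R g W r gW c s s0 sr rc.
have [qm|mq] := leP (c + r) m.
  have : W1 (c + r) - W1 (c - r) = W (c + r) - W (c - r).
    by rewrite /W1 !min_l//; lra.
  lra.
have [Mp|pM] := leP M (c - r).
  have : W2 (c + r) - W2 (c - r) = W (c + r) - W (c - r).
    by rewrite /W2 !max_l//; lra.
  lra.
have h : W3 (c + r) - W3 (c - r) = eta * (2 * r).
  by rewrite /W3 !min_l; [ring|lra|lra].
have k : `|g (c + s) + g (c - s) - 2 * g c| <= eta * s by apply: sr1; lra.
have k' : eta * s <= eta * r by rewrite ler_wpM2l ?(ltW eta0).
have k'' : 0 <= eta * r by rewrite mulr_ge0// ?ltW.
lra.
Unshelve. all: by end_near. Qed.

(** * Alternating and midpoint sums *)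

Section alternating_sums.
Variables (R : realType) (g W : R -> R) (u h : R).
Hypotheses (u0 : 0 <= u) (h0 : 0 < h).
Let a k := g ((k%:R + u) * h).

Definition alternating_sum n := \sum_(1 <= k < n.+1) (-1) ^+ k.-1 * (2 * a k).

Lemma sample_point_ge0 n : 0 <= (n%:R + u) * h.
Proof. by rewrite mulr_ge0 ?addr_ge0// ltW. Qed.

Lemma sample_point_le m n : (m <= n)%N -> (m%:R + u) * h <= (n%:R + u) * h.
Proof. by move=> mn; rewrite ler_pM2r// lerD2r ler_nat. Qed.

Lemma sample_point_cvgy : (n%:R + u) * h @[n --> \oo] --> +oo.
Proof.
apply/cvgryPge => A; near=> n.
rewrite -ler_pdivrMr// (@le_trans _ _ n%:R) ?lerDl//.
by near: n; apply: cvgry_ge; exact: cvgr_idn.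
Unshelve. all: by end_near. Qed.

Lemma sample_cvg0 : g x @[x --> +oo] --> 0 -> a n @[n --> \oo] --> 0.
Proof. exact: (cvg_comp _ _ sample_point_cvgy). Qed.

Lemma alternating_sumS n : alternating_sum n.+1 =
  a 1 + \sum_(0 <= k < n) (-1) ^+ k * (a k.+1 - a k.+2) + (-1) ^+ n * a n.+1.
Proof.
elim: n => [|n IHn].
  by rewrite /alternating_sum big_nat1 big_nil expr0; ring.
rewrite /alternating_sum big_nat_recr//= -/(alternating_sum _) IHn.
by rewrite [in RHS]big_nat_recr//= exprS; ring.
Qed.

(** Summation by parts leaves a series whose terms are dominated by the
    increments of [W], hence absolutely convergent, and a boundary term
    tending to [0]. *)
Lemma is_cvg_alternating_sum V : variation_bound g W ->
  (forall x, 0 <= x -> W x <= V) -> g x @[x --> +oo] --> 0 ->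
  cvgn alternating_sum.
Proof.
move=> gW WV g0.
have E0 : cvgn [sequence alternating_sum n.+1]_n -> cvgn alternating_sum.
  move=> /cvg_ex[l]; rewrite (cvg_shiftS alternating_sum) => cl.
  by apply/cvg_ex; exists l.
apply: E0.
have -> : [sequence alternating_sum n.+1]_n =
  (fun n => a 1 + series (fun k => (-1) ^+ k * (a k.+1 - a k.+2)) n + (-1) ^+ n * a n.+1).
  by apply/funext => n /=; rewrite alternating_sumS.
apply: is_cvgD.
  apply: is_cvgD; first exact: is_cvg_cst.
  apply: normed_cvg; apply: nondecreasing_is_cvgn.
    by apply: nondecreasing_series => n _ _; exact: normr_ge0.
  exists (V - W ((1%:R + u) * h)) => _ [n _ <-] /=.
  apply: (@le_trans _ _ (W ((n.+1%:R + u) * h) - W ((1%:R + u) * h))); last first.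
    by rewrite lerD2r WV// sample_point_ge0.
  rewrite /series/=; elim: n => [|n IHn]; first by rewrite big_nil subrr.
  rewrite big_nat_recr//= normrM normrX normrN1 expr1n mul1r.
  have dn := gW _ _ (sample_point_ge0 n.+1) (sample_point_le (leqnSn n.+1)).
  rewrite distrC (le_trans (lerD IHn dn))//.
  by rewrite addrC subrKA.
apply/cvg_ex; exists 0; apply/cvgr0Pnorm_le => e e0.
have : a n.+1 @[n --> \oo] --> 0 by rewrite (cvg_shiftS a); exact: sample_cvg0.
move=> /cvgr0Pnorm_le/(_ e e0); apply: filterS => n.
by rewrite normrM normrX normrN1 expr1n mul1r.
Qed.

(** Two consecutive terms of the sum contribute the second difference of [g] at
    an even sample point, on a cell of radius [h]. *)
Lemma alternating_sum_even n : second_diff_bound g W h ->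
  `|alternating_sum (2 * n) - a 1 + a (2 * n).+1| <=
    W (((2 * n).+1%:R + u) * h) - W ((1%:R + u) * h).
Proof.
move=> gW; elim: n => [|n IHn].
  by rewrite muln0 /alternating_sum big_geq// sub0r addNr normr0 subrr.
have -> : alternating_sum (2 * n.+1) = alternating_sum (2 * n)
    + 2 * a (2 * n).+1 - 2 * a (2 * n).+2.
  rewrite mulnS !add2n {1}/alternating_sum big_nat_recr// big_nat_recr//=.
  by rewrite -/(alternating_sum _) exprS exprM sqrrN !expr1n; ring.
have -> : (2 * n.+1).+1 = (2 * n).+3 by rewrite mulnS.
have -> : alternating_sum (2 * n) + 2 * a (2 * n).+1 - 2 * a (2 * n).+2
   - a 1 + a (2 * n).+3 = (alternating_sum (2 * n) - a 1 + a (2 * n).+1) +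
  (a (2 * n).+3 + a (2 * n).+1 - 2 * a (2 * n).+2) by ring.
have := gW (((2 * n).+2%:R + u) * h) h (ltW h0) (lexx h).
have -> : ((2 * n).+2%:R + u) * h + h = ((2 * n).+3%:R + u) * h.
  by rewrite -[(2 * n).+3]addn1 natrD; ring.
have -> : ((2 * n).+2%:R + u) * h - h = ((2 * n).+1%:R + u) * h.
  by rewrite -[(2 * n).+2]addn1 natrD; ring.
have hn : h <= ((2 * n).+2%:R + u) * h.
  by rewrite ler_peMl ?(ltW h0)// (@le_trans _ _ (2 * n).+2%:R) ?ler1n// lerDl.
move=> /(_ hn) b; apply: (le_trans (ler_normD _ _)).
by apply: (le_trans (lerD IHn b)); lra.
Qed.

Lemma lim_alternating_sum_near e :
  cvgn alternating_sum -> g x @[x --> +oo] --> 0 -> second_diff_bound g W h ->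
  (forall n, W ((n.+1%:R + u) * h) - W ((1 + u) * h) <= e) ->
  `|limn alternating_sum - g ((1 + u) * h)| <= e.
Proof.
move=> cS g0 gW We.
have : alternating_sum (2 * n)%N - a 1 + a (2 * n).+1 @[n --> \oo] -->
    limn alternating_sum - a 1 + 0.
  apply: cvgD.
    apply: cvgB; last exact: cvg_cst.
    exact: (cvg_comp _ _ (@cvg_mulnl 2 isT) cS).
  apply: (@cvg_comp _ _ _ (fun n => 2 * n)%N (fun n => a n.+1) _ _ _ (@cvg_mulnl 2 isT)).
  by rewrite (cvg_shiftS a); exact: sample_cvg0.
rewrite addr0 => /cvg_norm/cvgr_to_le; apply.
by near=> n; exact: (le_trans (alternating_sum_even _ gW)).
Unshelve. all: by end_near. Qed.

End alternating_sums.

Section midpoint_sums.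
Variables (R : realType) (g F W : R -> R).
Hypothesis dF : forall x : R, 0 < x -> is_derive x 1 F (g x).

(** As a function of the radius, the midpoint error has the second difference of
    [g] as derivative. *)
Lemma midpoint_cell (r c : R) : second_diff_bound g W r -> 0 <= r -> r < c ->
  `|2 * r * g c - (F (c + r) - F (c - r))| <= r * (W (c + r) - W (c - r)).
Proof.
move=> gW r0 rc.
pose q s := F (c + s) - F (c - s) - 2 * g c * s.
have dq s : s \in `[0, r]%R -> is_derive s 1 q (g (c + s) + g (c - s) - 2 * g c).
  rewrite in_itv/= => /andP[s0 sr].
  have d1 : is_derive s 1 (fun s => F (c + s)) (g (c + s) * 1).
    apply: (@is_derive1_comp R F (fun s => c + s)); first by apply: dF; lra.
    by apply: is_derive_eq; ring.
  have d2 : is_derive s 1 (fun s => F (c - s)) (g (c - s) * -1).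
    apply: (@is_derive1_comp R F (fun s => c - s)); first by apply: dF; lra.
    by apply: is_derive_eq; ring.
  apply: is_derive_eq.
  by rewrite -[_%:A]/(_ * 1); ring.
have dq' s : s \in `]0, r[%R -> is_derive s 1 q (g (c + s) + g (c - s) - 2 * g c).
  by move=> sr; apply: dq; exact: (subset_itv_oo_cc sr).
have cq : {within `[0, r], continuous q}.
  by apply: derivable_within_continuous => s sr; case: (dq s sr).
have [s sr E] := MVT_segment r0 dq' cq.
have q0 : q 0 = 0 by rewrite /q addr0 subr0 subrr mulr0 subr0.
move: E; rewrite q0 !subr0 /q => E.
rewrite distrC (_ : F (c + r) - F (c - r) - 2 * r * g c =
  (g (c + s) + g (c - s) - 2 * g c) * r); last by rewrite -E; ring.
rewrite normrM (ger0_norm r0) mulrC ler_wpM2l//.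
by move: sr; rewrite in_itv/= => /andP[s0 sr]; apply: gW => //; exact: ltW.
Qed.

Variables (u h : R).
Hypotheses (u0 : 0 <= u) (h0 : 0 < h).

Definition sample_sum n := \sum_(1 <= k < n.+1) 2 * g ((k%:R + u) * h).

Lemma midpoint_sum n : second_diff_bound g W (h / 2) ->
  `|sample_sum n - 2 / h * (F ((n%:R + u + 1/2) * h) - F ((u + 1/2) * h))| <=
  W ((n%:R + u + 1/2) * h) - W ((u + 1/2) * h).
Proof.
move=> gW; elim: n => [|n IHn].
  by rewrite /sample_sum big_geq// sub0r !add0r !subrr mulr0 oppr0 normr0.
rewrite /sample_sum big_nat_recr//= -/(sample_sum n).
(* the cells of radius [h / 2] centred at the sample points are adjacent *)
pose c := (n.+1%:R + u) * h.
have cE1 : (n.+1%:R + u + 1/2) * h = c + h / 2 by rewrite /c; field.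
have cE2 : (n%:R + u + 1/2) * h = c - h / 2 by rewrite /c -addn1 natrD; field.
have n0 : 0 <= n%:R :> R by [].
have hc : h / 2 < c.
  rewrite /c mulrC ltr_pM2r// -[n.+1]addn1 natrD. rewrite addrAC.
  apply: (@lt_le_trans _ _ 1); first by rewrite invf_lt1 ?ltr1n.
  by rewrite lerDr addr_ge0.
have := midpoint_cell gW (ltW (divr_gt0 h0 (ltr0n R 2))) hc.
rewrite -cE1 -cE2 -/c => b.
set X := W (_ * h) in b *; set Y := W (_ * h) in b IHn *.
set FX := F (_ * h) in b *; set FY := F (_ * h) in b IHn *; set FZ := F (_ * h) in IHn *.
have -> : sample_sum n + 2 * g c - 2 / h * (FX - FZ) =
  (sample_sum n - 2 / h * (FY - FZ)) + 2 / h * (2 * (h / 2) * g c - (FX - FY)).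
  by field; rewrite gt_eqF.
apply: (le_trans (ler_normD _ _)).
have h2 : 0 <= 2 / h by rewrite divr_ge0// ltW.
rewrite [X in _ + X <= _]normrM (ger0_norm h2).
have := ler_wpM2l h2 b.
rewrite (_ : 2 / h * (h / 2 * (X - Y)) = X - Y); last by field; rewrite gt_eqF.
lra.
Qed.

(** By the mean value theorem [F x] is [x] times a value of [g] on [[0, x]]. *)
Lemma primitive_near0 x : variation_bound g W -> W 0 = 0 ->
  F 0 = 0 -> F x @[x --> 0^'+] --> 0 -> 0 < x -> `|F x - x * g 0| <= x * W x.
Proof.
move=> gW W0 F0 cF x0.
have [||z zx] := @MVT_segment R F g 0 x (ltW x0).
- by move=> z; rewrite in_itv/= => /andP[z0 _]; exact: dF.
- apply: derivable_oo_LRcontinuous_within; split.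
  + by move=> z; rewrite in_itv/= => /andP[z0 _]; case: (dF z0).
  + by rewrite F0.
  + apply: cvg_at_left_filter; apply/differentiable_continuous/derivable1_diffP.
    by case: (dF x0).
rewrite F0 !subr0 mulrC => ->; rewrite -mulrBr normrM (gtr0_norm x0) ler_pM2l//.
move: zx; rewrite in_itv/= => /andP[z0 zx].
apply: (le_trans (gW _ _ (lexx 0) z0)); rewrite W0 subr0.
exact: (variation_bound_homo gW z0 zx).
Qed.

End midpoint_sums.

(** * Bounds on the remainders *)

Section remainders.
Variables (R : realType) (g g' W : R -> R) (V : R).
Hypotheses (gW : variation_bound g W) (W0 : W 0 = 0).
Hypothesis WV : forall x, 0 <= x -> W x <= V.
Hypothesis W_near0 : W x @[x --> 0^'+] --> 0.
Hypothesis W_neary : W x @[x --> +oo] --> V.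
Hypothesis dg : forall x : R, 0 < x -> is_derive x 1 g (g' x).
Hypothesis cg' : forall x : R, 0 < x -> {for x, continuous g'}.
Hypothesis gy : g x @[x --> +oo] --> 0.

Lemma variation_bound_small (A e : R) : 0 < A -> 0 < e ->
  exists2 d, 0 < d & forall h, 0 < h -> h <= d -> W (A * h) <= e.
Proof.
move=> A0 e0; have /cvgrPdist_le/(_ e e0) H := W_near0.
near (0 : R)^'+ => m.
have m0 : 0 < m by near: m; exact: nbhs_right_gt.
have Wm : `|0 - W m| <= e by near: m.
exists (m / A); first by rewrite divr_gt0.
move=> h h0; rewrite ler_pdivlMr// mulrC => hm.
move: Wm; rewrite sub0r normrN; apply: le_trans; apply: le_trans (ler_norm _).
by apply: (variation_bound_homo gW) => //; rewrite mulr_ge0// ltW.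
Unshelve. all: by end_near. Qed.

(** The second differences cost at most [V - W x1], where [x1] is the first
    sample point, and replacing [g x1] by [g 0] costs at most [W x1]. *)
Lemma alternating_remainder_le u h : 0 <= u -> 0 < h ->
  `|limn (alternating_sum g u h) - g 0| <= V.
Proof.
move=> u0 h0; have x1 : 0 <= (1 + u) * h := sample_point_ge0 u0 h0 1.
have h1 : `|limn (alternating_sum g u h) - g ((1 + u) * h)| <=
    V - W ((1 + u) * h).
  apply: (lim_alternating_sum_near u0 h0 (is_cvg_alternating_sum u0 h0 gW WV gy) gy
    (@variation_second_diff_bound _ _ _ h gW)).
  by move=> n; rewrite lerD2r; apply: WV; exact: sample_point_ge0.
have := gW (lexx 0) x1; rewrite W0 subr0 => h2.
apply: (le_trans (ler_distD (g ((1 + u) * h)) _ _)); lra.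
Qed.

Lemma alternating_remainder_small a e : 0 <= a -> 0 < e ->
  exists2 d, 0 < d & forall u h, 0 <= u -> u <= a -> 0 < h -> h <= d ->
    `|limn (alternating_sum g u h) - g 0| <= e.
Proof.
move=> a0 e0; have e20 : 0 < e / 2 by rewrite divr_gt0.
have [W' W'e [r0 r00 gW']] :=
  second_diff_bound_small gW W0 W_near0 W_neary dg cg' e20.
have [d d0 Wd] := variation_bound_small (ltr_pwDl ltr01 a0) e20.
exists (Num.min r0 d); first by rewrite lt_min r00 d0.
move=> u h u0 ua h0; rewrite le_min => /andP[hr hd].
have x1 : 0 <= (1 + u) * h := sample_point_ge0 u0 h0 1.
have h1 : `|limn (alternating_sum g u h) - g ((1 + u) * h)| <= e / 2.
  apply: (lim_alternating_sum_near u0 h0 (is_cvg_alternating_sum u0 h0 gW WV gy) gy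
    (gW' h h0 hr)).
  move=> n; have /andP[_] := W'e _ (sample_point_ge0 u0 h0 n.+1).
  by have /andP[] := W'e _ x1; lra.
have := gW (lexx 0) x1; rewrite W0 subr0 => h2.
have h3 : W ((1 + u) * h) <= W ((1 + a) * h).
  by apply: (variation_bound_homo gW) => //; rewrite ler_pM2r// lerD2l.
have h4 := Wd h h0 hd.
apply: (le_trans (ler_distD (g ((1 + u) * h)) _ _)); lra.
Qed.

Variables (F : R -> R) (l : R).
Hypothesis g_ge0 : forall x, 0 <= x -> 0 <= g x.
Hypothesis dF : forall x : R, 0 < x -> is_derive x 1 F (g x).
Hypothesis F0 : F 0 = 0.
Hypothesis F_near0 : F x @[x --> 0^'+] --> 0.
Hypothesis F_neary : F x @[x --> +oo] --> l.
Hypothesis Fl : forall x, 0 < x -> F x <= l.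

Lemma is_cvg_sample_sum u h : 0 <= u -> 0 < h -> cvgn (sample_sum g u h).
Proof.
move=> u0 h0; apply: nondecreasing_is_cvgn.
  apply/nondecreasing_seqP => n; rewrite /sample_sum [leRHS]big_nat_recr//= lerDl.
  by rewrite mulr_ge0// g_ge0// sample_point_ge0.
exists (V - W ((u + 1/2) * h) + 2 / h * (l - F ((u + 1/2) * h))) => _ [n _ <-].
have := midpoint_sum dF u0 h0 n (@variation_second_diff_bound _ _ _ (h / 2) gW).
have nh : 0 < (n%:R + u + 1/2) * h by rewrite mulr_gt0// ltr_wpDl// addr_ge0.
have := ler_wpM2l (divr_ge0 (ler0n R 2) (ltW h0)) (Fl nh).
have := WV (ltW nh); rewrite !mulrBr ler_norml => ? ? /andP[_]; lra.
Qed.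

(** The first cell starts at [y = (u + 1/2) h].  The midpoint rule is responsible
    for [E]; the second summand is the error made on [[0, y]] in replacing the
    integral of [g] by [y * g 0]. *)
Lemma midpoint_remainder_near (W' : R -> R) E u h : 0 <= u -> 0 < h ->
  second_diff_bound g W' (h / 2) ->
  (forall n, W' ((n%:R + u + 1/2) * h) - W' ((u + 1/2) * h) <= E) ->
  `|limn (sample_sum g u h) - 2 / h * l + (1 + 2 * u) * g 0| <=
  E + (1 + 2 * u) * W ((u + 1/2) * h).
Proof.
move=> u0 h0 gW' W'E.
pose y := (u + 1/2) * h.
have y0 : 0 < y by rewrite mulr_gt0// ltr_wpDl.
have h20 : 0 <= 2 / h by rewrite divr_ge0// ltW.
have cF : F ((n%:R + u + 1/2) * h) @[n --> \oo] --> l.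
  apply: (@cvg_comp _ _ _ (fun n : nat => (n%:R + u + 1/2) * h) F _ _ _ _ F_neary).
  under eq_fun do rewrite -addrA.
  by apply: sample_point_cvgy => //; rewrite addr_ge0.
have : sample_sum g u h n - 2 / h * F ((n%:R + u + 1/2) * h) + (1 + 2 * u) * g 0
    @[n --> \oo] --> limn (sample_sum g u h) - 2 / h * l + (1 + 2 * u) * g 0.
  apply: cvgD; last exact: cvg_cst.
  apply: cvgB; first exact: is_cvg_sample_sum.
  by apply: cvgM => //; exact: cvg_cst.
move=> /cvg_norm/cvgr_to_le; apply; near=> n.
set X := F (_ * h).
have -> : sample_sum g u h n - 2 / h * X + (1 + 2 * u) * g 0 =
  (sample_sum g u h n - 2 / h * (X - F y)) - 2 / h * (F y - y * g 0).
  by rewrite /y; field; rewrite gt_eqF.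
apply: (le_trans (ler_normB _ _)); apply: lerD.
  exact: le_trans (midpoint_sum dF u0 h0 n gW') (W'E n).
rewrite normrM (ger0_norm h20).
have -> : (1 + 2 * u) * W y = 2 / h * (y * W y).
  by rewrite /y; field; rewrite gt_eqF.
by rewrite ler_wpM2l// primitive_near0.
Unshelve. all: by end_near. Qed.

(** With [W' = W] the previous bound reads [V - W y + (1 + 2 u) W y], and
    [2 u W y <= 2 u V]. *)
Lemma midpoint_remainder_le u h : 0 <= u -> 0 < h ->
  `|limn (sample_sum g u h) - 2 / h * l + (1 + 2 * u) * g 0| <= (1 + 2 * u) * V.
Proof.
move=> u0 h0.
have y0 : 0 <= (u + 1/2) * h by rewrite mulr_ge0 ?addr_ge0// ltW.
have := @midpoint_remainder_near W (V - W ((u + 1/2) * h)) u h u0 h0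
  (@variation_second_diff_bound _ _ _ (h / 2) gW).
have H n : W ((n%:R + u + 1/2) * h) - W ((u + 1/2) * h) <= V - W ((u + 1/2) * h).
  by rewrite lerD2r; apply: WV; rewrite mulr_ge0 ?addr_ge0// ltW.
move=> /(_ H)/le_trans; apply.
have := WV y0; nra.
Qed.

Lemma midpoint_remainder_small a e : 0 <= a -> 0 < e ->
  exists2 d, 0 < d & forall u h, 0 <= u -> u <= a -> 0 < h -> h <= d ->
    `|limn (sample_sum g u h) - 2 / h * l + (1 + 2 * u) * g 0| <= e.
Proof.
move=> a0 e0; have e20 : 0 < e / 2 by rewrite divr_gt0.
have [W' W'e [r0 r00 gW']] :=
  second_diff_bound_small gW W0 W_near0 W_neary dg cg' e20.
have A0 : 0 < a + 1/2 by rewrite ltr_wpDl.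
have B0 : 0 < 1 + 2 * a by rewrite ltr_pwDl// mulr_ge0.
have [d d0 Wd] := variation_bound_small A0 (divr_gt0 e20 B0).
exists (Num.min r0 d); first by rewrite lt_min r00 d0.
move=> u h u0 ua h0; rewrite le_min => /andP[hr hd].
have y0 : 0 <= (u + 1/2) * h by rewrite mulr_ge0 ?addr_ge0// ltW.
have hr2 : h / 2 <= r0 by lra.
have := midpoint_remainder_near u0 h0 (gW' (h / 2) (divr_gt0 h0 (ltr0n R 2)) hr2).
move=> /(_ (e / 2))H; apply: (le_trans (H _)).
  move=> n.
  have nh : 0 <= (n%:R + u + 1/2) * h by rewrite mulr_ge0 ?addr_ge0// ltW.
  by have /andP[_ +] := W'e _ nh; have /andP[+ _] := W'e _ y0; lra.
have Wy0 : 0 <= W ((u + 1/2) * h) by rewrite -W0 (variation_bound_homo gW).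
have Wyd : W ((u + 1/2) * h) <= e / 2 / (1 + 2 * a).
  apply: le_trans (Wd h h0 hd); apply: (variation_bound_homo gW) => //.
  by rewrite ler_pM2r// lerD2r.
rewrite [leRHS](splitr e) lerD2l.
apply: (@le_trans _ _ ((1 + 2 * a) * (e / 2 / (1 + 2 * a)))).
  by apply: ler_pM => //; [rewrite addr_ge0// mulr_ge0|rewrite lerD2l ler_pM2l].
by rewrite mulrC divfK ?gt_eqF.
Qed.

End remainders.

(** * Total variation of a unimodal function *)

Section unimodal.
Variables (R : realType) (g : R -> R) (m : R).
Hypotheses (m0 : 0 <= m).
Hypothesis g_incr : forall x y, 0 <= x -> x <= y -> y <= m -> g x <= g y.
Hypothesis g_decr : forall x y, m <= x -> x <= y -> g y <= g x.

(** For [0 <= x] this is the variation of [g] on [[0, x]]. *)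
Definition unimodal_variation x :=
  g (Num.min x m) - g 0 + (g m - g (Num.max x m)).

Lemma unimodal_variation_bound : variation_bound g unimodal_variation.
Proof.
move=> x y x0 xy; rewrite /unimodal_variation.
have [xm|mx] := leP x m; have [ym|my] := leP y m; last 2 first.
- lra.
- have := g_decr (ltW mx) xy; rewrite ler_norml; lra.
- have := g_incr x0 xy ym; rewrite ler_norml; lra.
- have := g_incr x0 xm (lexx m); have := g_decr (lexx m) (ltW my).
  rewrite ler_norml; lra.
Qed.

Lemma unimodal_variation0 : unimodal_variation 0 = 0.
Proof. by rewrite /unimodal_variation (min_l m0) (max_r m0) !subrr addr0. Qed.

Lemma unimodal_variation_near0 :
  g x @[x --> 0^'+] --> g 0 -> unimodal_variation x @[x --> 0^'+] --> 0.
Proof.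
move=> g0; rewrite /unimodal_variation.
have [m_gt0|m_le0] := ltP 0 m.
  have : g x - g 0 @[x --> 0^'+] --> g 0 - g 0.
    by apply: cvgB => //; exact: cvg_cst.
  rewrite subrr; apply: cvg_trans; apply: near_eq_cvg; near=> x.
  have xm : x <= m by near: x; exact: nbhs_right_le.
  by rewrite (min_l xm) (max_r xm) subrr addr0.
have -> : m = 0 by apply/eqP; rewrite eq_le m_le0.
have : g 0 - g x @[x --> 0^'+] --> g 0 - g 0.
  by apply: cvgB => //; exact: cvg_cst.
rewrite subrr; apply: cvg_trans; apply: near_eq_cvg; near=> x.
have x0 : 0 <= x by near: x; exact: nbhs_right_ge.
by rewrite (min_r x0) (max_l x0) subrr add0r.
Unshelve. all: by end_near. Qed.

Lemma unimodal_variation_neary : g x @[x --> +oo] --> 0 ->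
  unimodal_variation x @[x --> +oo] --> 2 * g m - g 0.
Proof.
move=> gy; have : g m - g 0 + (g m - g x) @[x --> +oo] --> g m - g 0 + (g m - 0).
  by apply: cvgD; [exact: cvg_cst|apply: cvgB => //; exact: cvg_cst].
rewrite (_ : g m - g 0 + (g m - 0) = 2 * g m - g 0); last by ring.
apply: cvg_trans; apply: near_eq_cvg; near=> x.
have xm : m <= x by near: x; exact: nbhs_pinfty_ge (num_real m).
by rewrite /unimodal_variation (min_r xm) (max_l xm).
Unshelve. all: by end_near. Qed.

Hypothesis g_ge0 : forall x, 0 <= x -> 0 <= g x.

Lemma unimodal_variation_le x : 0 <= x -> unimodal_variation x <= 2 * g m - g 0.
Proof.
move=> x0; rewrite /unimodal_variation.
have h1 : g (Num.min x m) <= g m.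
  by apply: g_incr; rewrite ?le_min ?x0 ?m0// ge_min lexx orbT.
have h2 : 0 <= g (Num.max x m) by apply: g_ge0; rewrite le_max x0.
lra.
Qed.

Lemma unimodal_total_variation b : m <= b ->
  total_variation 0 b g = (unimodal_variation b)%:E.
Proof.
move=> mb; rewrite (total_variationD g m0 mb).
rewrite nondecreasing_total_variation//; last first.
  move=> x y; rewrite !in_itv/= => /andP[x0 _] /andP[_ ym] xy; exact: g_incr.
rewrite -[X in (_ + X)%E]total_variationN nondecreasing_total_variation//; last first.
  by move=> x y; rewrite !in_itv/= => /andP[mx _] _ xy; rewrite lerN2 g_decr.
rewrite -EFinD /unimodal_variation (min_r mb) (max_l mb).
by congr (_%:E); rewrite /=; ring.
Qed.

Lemma unimodal_variations_le v : ray_variations 0 g v -> v <= 2 * g m - g 0.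
Proof.
move=> [b /=]; rewrite in_itv/= andbT => b0 vb.
have mb : m <= Num.max b m by rewrite le_max lexx orbT.
have bb : b <= Num.max b m by rewrite le_max lexx.
rewrite -lee_fin.
apply: (@le_trans _ _ (total_variation 0 b g)).
  by apply: ereal_sup_ubound; exists v.
apply: (@le_trans _ _ (total_variation 0 (Num.max b m) g)).
  by rewrite (total_variationD g b0 bb) leeDl// total_variation_ge0.
rewrite unimodal_total_variation// lee_fin unimodal_variation_le//.
exact: le_trans bb.
Qed.

Lemma unimodal_ray_bounded_variation : ray_bounded_variation 0 g.
Proof. by exists (2 * g m - g 0) => v /unimodal_variations_le. Qed.

(** The variation on [[0, b]] equals [unimodal_variation b] once [b] has passed
    the mode, and this tends to [2 g m - g 0] because the descent is from
    [g m] to [0]. *)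
Lemma unimodal_ray_total_variation : g x @[x --> +oo] --> 0 ->
  ray_total_variation 0 g = (2 * g m - g 0)%:E.
Proof.
move=> gy; apply/eqP; rewrite eq_le; apply/andP; split.
  by apply: ge_ereal_sup => _ [v /unimodal_variations_le vV <-]; rewrite lee_fin.
apply/lee_addgt0Pr => e e0.
have /cvgrPdist_le/(_ e e0) H := unimodal_variation_neary gy.
near (+oo_R) => b.
have mb : m <= b by near: b; exact: nbhs_pinfty_ge (num_real m).
have Hb : `|2 * g m - g 0 - unimodal_variation b| <= e by near: b.
apply: (@le_trans _ _ ((unimodal_variation b)%:E + e%:E)).
  by rewrite -EFinD lee_fin; move: Hb; rewrite ler_norml; lra.
rewrite leeD2r// -unimodal_total_variation//.
apply: ereal_sup_le => _ [v vb <-]; exists v => //; exists b => //=.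
by rewrite in_itv/= andbT (le_trans m0).
Unshelve. all: by end_near. Qed.

End unimodal.

(** * The function g *)

Lemma is_derive_continuous (R : realType) (f : R -> R) (x l : R) :
  is_derive x 1 f l -> {for x, continuous f}.
Proof. by case=> df _; exact/differentiable_continuous/derivable1_diffP. Qed.

Lemma gt0_powRD (R : realType) (x a b : R) :
  0 < x -> x `^ (a + b) = x `^ a * x `^ b.
Proof. by move=> x0; apply: powRD; rewrite (gt_eqF x0) implybT. Qed.

Section mathieu_g_facts.
Variables (R : realType) (gamma alpha mu delta : R).
Hypotheses (gamma0 : 0 <= gamma) (alpha0 : 0 < alpha).
Hypotheses (deltaE : delta = alpha * (mu + 1) - gamma) (delta0 : 0 < delta).
Let g := mathieu_g gamma alpha mu.

(** The derivative of [g], in the factored form that shows its sign. *)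
Definition mathieu_g' x := x `^ (gamma - 1) * (x `^ alpha + 1) `^ (- mu - 2)
  * (gamma - delta * x `^ alpha).

Definition mathieu_mode := (gamma / delta) `^ (alpha^-1).

Lemma mathieu_mode_ge0 : 0 <= mathieu_mode.
Proof. exact: powR_ge0. Qed.

Lemma mathieu_mode_powR : mathieu_mode `^ alpha = gamma / delta.
Proof.
by rewrite /mathieu_mode -powRrM mulVf ?gt_eqF// powRr1// divr_ge0// ltW.
Qed.

Lemma powR_add1_gt0 (x : R) : 0 < x `^ alpha + 1.
Proof. by rewrite ltr_wpDl// powR_ge0. Qed.

Lemma mathieu_g_ge0 x : 0 <= g x.
Proof. by rewrite mulr_ge0// powR_ge0. Qed.

Lemma is_derive_mathieu_g (x : R) : 0 < x -> is_derive x 1 g (mathieu_g' x).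
Proof.
move=> x0; have X0 := powR_add1_gt0 x.
have d1 : is_derive x 1 (fun x => x `^ alpha + 1) (alpha * x `^ (alpha - 1)).
  rewrite -[X in is_derive _ _ _ X]addr0.
  exact: (is_deriveD (is_derive1_powR alpha x0) (is_derive_cst (1 : R) x 1)).
have d2 : is_derive x 1 (fun x => (x `^ alpha + 1) `^ (- mu - 1))
    ((- mu - 1) * (x `^ alpha + 1) `^ (- mu - 1 - 1) * (alpha * x `^ (alpha - 1))).
  exact: (@is_derive1_comp R (fun y => y `^ (- mu - 1)) (fun x => x `^ alpha + 1) x _ _
    (is_derive1_powR (- mu - 1) X0) d1).
have d3 : is_derive x 1 (fun x => x `^ gamma) (gamma * x `^ (gamma - 1)).
  exact: is_derive1_powR.
apply: (is_derive_eq (is_deriveM d3 d2)).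
rewrite -![_ *: _]/(_ * _) /mathieu_g'.
have e1 : x `^ gamma = x `^ (gamma - 1) * x.
  by rewrite -[X in _ * X](powRr1 (ltW x0)) -gt0_powRD// subrK.
have e2 : x `^ alpha = x `^ (alpha - 1) * x.
  by rewrite -[X in _ * X](powRr1 (ltW x0)) -gt0_powRD// subrK.
have e3 : (x `^ alpha + 1) `^ (- mu - 1) =
    (x `^ alpha + 1) `^ (- mu - 2) * (x `^ alpha + 1).
  rewrite -[X in _ = _ * X](powRr1 (ltW X0)) -gt0_powRD//.
  by congr (_ `^ _); ring.
have -> : - mu - 1 - 1 = - mu - 2 by ring.
by rewrite e3 e1 deltaE e2; ring.
Qed.

Lemma continuous_mathieu_g' (x : R) : 0 < x -> {for x, continuous mathieu_g'}.
Proof.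
move=> x0; have X0 := powR_add1_gt0 x.
have c a (y : R) : 0 < y -> {for y, continuous (fun y => y `^ a)}.
  by move=> y0; exact: is_derive_continuous (is_derive1_powR a y0).
apply: cvgM; first apply: cvgM; first exact: c.
  apply: (@cvg_comp _ _ _ (fun x => x `^ alpha + 1) (fun y => y `^ (- mu - 2)));
    last exact: (c _ _ X0).
  by apply: cvgD; [exact: c|exact: cvg_cst].
by apply: cvgB; [exact: cvg_cst|apply: cvgM; [exact: cvg_cst|exact: c]].
Qed.

Lemma mathieu_g_near0 : g x @[x --> 0^'+] --> g 0.
Proof.
rewrite /g /mathieu_g; apply: cvgM.
  have [->|gamma_neq0] := eqVneq gamma 0.
    rewrite powRr0; under eq_fun do rewrite powRr0; exact: cvg_cst.
  by rewrite powR0//; apply: powR_cvg0; rewrite lt_def gamma_neq0.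
rewrite powR0 ?gt_eqF// add0r.
have h1 : (x : R) `^ alpha + 1 @[x --> 0^'+] --> (1 : R).
  rewrite -[X in _ --> X]add0r; apply: cvgD; [exact: powR_cvg0|exact: cvg_cst].
exact: (cvg_comp _ _ h1 (is_derive_continuous (is_derive1_powR (- mu - 1) (@ltr01 R)))).
Qed.

Lemma mathieu_g_LRcontinuous a b : 0 <= a -> a < b ->
  derivable_oo_LRcontinuous g a b.
Proof.
move=> a0 ab; have c (x : R) : 0 < x -> {for x, continuous g}.
  by move=> x0; exact: is_derive_continuous (is_derive_mathieu_g x0).
split.
- move=> x; rewrite in_itv/= => /andP[ax _].
  by case: (is_derive_mathieu_g (le_lt_trans a0 ax)).
- move: a0; rewrite le_eqVlt => /predU1P[<-|a0]; first exact: mathieu_g_near0.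
  by apply: cvg_at_right_filter; exact: c.
- by apply: cvg_at_left_filter; apply: c; exact: le_lt_trans ab.
Qed.

Lemma mathieu_g_incr x y : 0 <= x -> x <= y -> y <= mathieu_mode -> g x <= g y.
Proof.
move=> x0; rewrite le_eqVlt => /predU1P[->//|xy] ym.
have dg z : z \in `]x, y[%R -> 0 < z /\ z <= mathieu_mode.
  by rewrite in_itv/= => /andP[xz zy]; split; lra.
apply: (@ger0_derive1_le_cc R g x y) => //; rewrite ?in_itv/= ?lexx ?(ltW xy)//.
- by move=> z /dg[z0 _]; case: (is_derive_mathieu_g z0).
- move=> z /dg[z0 zm]; rewrite derive1E; case: (is_derive_mathieu_g z0) => _ ->.
  rewrite !mulr_ge0 ?powR_ge0// subr_ge0 mulrC -ler_pdivlMr// -mathieu_mode_powR.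
  by apply: ge0_ler_powR; rewrite ?nnegrE ?mathieu_mode_ge0// ltW.
- exact/derivable_oo_LRcontinuous_within/mathieu_g_LRcontinuous.
Qed.

Lemma mathieu_g_decr x y : mathieu_mode <= x -> x <= y -> g y <= g x.
Proof.
move=> mx; rewrite le_eqVlt => /predU1P[->//|xy].
have x0 := le_trans mathieu_mode_ge0 mx.
have dg z : z \in `]x, y[%R -> 0 < z /\ mathieu_mode <= z.
  by rewrite in_itv/= => /andP[xz zy]; split; lra.
apply: (@ler0_derive1_le_cc R g x y) => //; rewrite ?in_itv/= ?lexx ?(ltW xy)//.
- by move=> z /dg[z0 _]; case: (is_derive_mathieu_g z0).
- move=> z /dg[z0 zm]; rewrite derive1E; case: (is_derive_mathieu_g z0) => _ ->.
  rewrite mulr_ge0_le0 ?mulr_ge0 ?powR_ge0// subr_le0 mulrC.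
  rewrite -ler_pdivrMr// -mathieu_mode_powR.
  by apply: ge0_ler_powR; rewrite ?nnegrE ?mathieu_mode_ge0// ltW.
- exact/derivable_oo_LRcontinuous_within/mathieu_g_LRcontinuous.
Qed.

(** The right-hand side is the tail of [g]: as [mu + 1] is positive,
    [x^alpha + 1] may be replaced by [x^alpha]. *)
Lemma mathieu_g_le (x : R) : 0 < x -> g x <= x `^ (- delta).
Proof.
move=> x0; have X0 := powR_add1_gt0 x.
have mu1 : 0 < mu + 1.
  by rewrite -(pmulr_rgt0 _ alpha0); rewrite (lt_le_trans delta0)// deltaE gerBl.
have -> : x `^ (- delta) = x `^ gamma * (x `^ alpha) `^ (- (mu + 1)).
  rewrite -powRrM -gt0_powRD//; congr (_ `^ _).
  by rewrite deltaE; ring.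
rewrite /g /mathieu_g ler_wpM2l ?powR_ge0// -opprD !powRN.
rewrite lef_pV2 ?posrE ?powR_gt0//.
apply: ge0_ler_powR; rewrite ?nnegrE ?powR_ge0// ?ltW//.
by rewrite ltrDl.
Qed.

Lemma mathieu_g_cvg0 : g x @[x --> +oo] --> 0.
Proof.
apply/cvgrPdist_le => e e0; near=> x.
have x0 : 0 < x by near: x; exact: nbhs_pinfty_gt (num_real _).
have xe : (e^-1) `^ (delta^-1) <= x by near: x; exact: nbhs_pinfty_ge (num_real _).
rewrite sub0r normrN ger0_norm ?mathieu_g_ge0//.
apply: (le_trans (mathieu_g_le x0)); rewrite powRN -[leRHS]invrK.
rewrite lef_pV2 ?posrE ?invr_gt0 ?powR_gt0//.
have -> : e^-1 = ((e^-1) `^ (delta^-1)) `^ delta.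
  by rewrite -powRrM mulVf ?gt_eqF// powRr1// invr_ge0 ltW.
by apply: ge0_ler_powR; rewrite ?nnegrE ?powR_ge0// ltW.
Unshelve. all: by end_near. Qed.

End mathieu_g_facts.

(** * The integral of g and the Beta function *)

Lemma powR_cvgy (R : realType) (a : R) : 0 < a -> x `^ a @[x --> +oo] --> +oo.
Proof.
move=> a0; apply/cvgryPge => A; near=> x.
apply: (@le_trans _ _ (Num.max A 0)); first by rewrite le_max lexx.
have M0 : 0 <= Num.max A 0 by rewrite le_max lexx orbT.
have Mx : Num.max A 0 `^ a^-1 <= x by near: x; exact: nbhs_pinfty_ge (num_real _).
rewrite -[leLHS]powRr1// -(mulVf (lt0r_neq0 a0)) powRrM.
apply: ge0_ler_powR; rewrite ?nnegrE ?powR_ge0 ?(ltW a0)//.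
Unshelve. all: by end_near. Qed.

Section primitive.
Variables (R : realType) (g : R -> R).
Hypothesis cg : forall b, 0 < b -> {within `[0, b], continuous g}.
Hypothesis g_ge0 : forall x, 0 <= g x.

Definition primitive x := parameterized_integral (@lebesgue_measure R) 0 x g.

Lemma primitive_integrable b : 0 < b ->
  (@lebesgue_measure R).-integrable `[0, b] (EFin \o g).
Proof.
move=> b0; apply: continuous_compact_integrable; first exact: segment_compact.
exact: cg.
Qed.

Lemma is_derive_primitive (x : R) : 0 < x -> is_derive x 1 primitive (g x).
Proof.
move=> x0; have x1 : 0 < x + 1 by rewrite addr_gt0.
have xx1 : x < x + 1 by rewrite ltrDl.
have cx : {for x, continuous g}.
  apply: (within_continuous_continuous x1 (cg x1)).
  by rewrite in_itv/= x0.
have [dF F'] := continuous_FTC1_closed xx1 (primitive_integrable x1) x0 cx.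
split; first exact: dF.
by rewrite -derive1E; exact: F'.
Qed.

Lemma primitive0 : primitive 0 = 0.
Proof. by rewrite /primitive/parameterized_integral set_itv1 Rintegral_set1. Qed.

Lemma primitive_cvg0 : primitive x @[x --> (0 : R)] --> (0 : R).
Proof.
exact: (parameterized_integral_cvg_left ltr01 (primitive_integrable ltr01)).
Qed.

Lemma primitive_ge0 x : 0 <= primitive x.
Proof. by apply: Rintegral_ge0. Qed.

Lemma primitive_homo : {homo primitive : x y / x <= y}.
Proof.
move=> x y; have [x0 _|x0] := ltP x 0.
  rewrite {1}/primitive /parameterized_integral set_itv_ge ?bnd_simp ?leNgt ?x0//.
  by rewrite Rintegral_set0 -leNgt primitive_ge0.
rewrite le_eqVlt => /predU1P[->//|xy].
apply: (@ger0_derive1_le_cc R primitive x y) => //; rewrite ?in_itv/= ?lexx ?(ltW xy)//.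
- move=> z; rewrite in_itv/= => /andP[xz _].
  by case: (is_derive_primitive (le_lt_trans x0 xz)).
- move=> z; rewrite in_itv/= => /andP[xz _]; rewrite derive1E.
  by case: (is_derive_primitive (le_lt_trans x0 xz)) => _ ->.
have y0 := le_lt_trans x0 xy.
have cF := parameterized_integral_continuous (ltW y0) (primitive_integrable y0).
apply: continuous_subspaceW cF.
by apply: subset_itvr; rewrite bnd_simp.
Qed.

End primitive.

Section mathieu_integral.
Variables (R : realType) (gamma alpha mu delta : R).
Hypotheses (gamma0 : 0 <= gamma) (alpha0 : 0 < alpha).
Hypotheses (deltaE : delta = alpha * (mu + 1) - gamma) (delta1 : 1 < delta).
Let delta0 : 0 < delta. Proof. exact: lt_trans delta1. Qed.
Let g := mathieu_g gamma alpha mu.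
Let F := primitive g.

Lemma within_continuous_mathieu_g b : 0 < b -> {within `[0, b], continuous g}.
Proof.
move=> b0; apply: derivable_oo_LRcontinuous_within.
exact: (mathieu_g_LRcontinuous gamma0 alpha0 deltaE (lexx 0) b0).
Qed.

Let dF (x : R) : 0 < x -> is_derive x 1 F (g x).
Proof. exact: (is_derive_primitive within_continuous_mathieu_g). Qed.

Let F_homo : {homo F : x y / x <= y}.
Proof. exact: (primitive_homo within_continuous_mathieu_g (mathieu_g_ge0 _ _ _)). Qed.

(** Beyond [1], [g] is compared with [x^(-delta)], of which
    [x^(1 - delta) / (1 - delta)] is a primitive. *)
Lemma primitive_mathieu_g_le x : F x <= F 1 + (delta - 1)^-1.
Proof.
have d1 : 0 < delta - 1 by rewrite subr_gt0.
have [x1|x1] := leP x 1.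
  by rewrite (le_trans (F_homo x1))// lerDl invr_ge0 ltW.
pose q y := F y + (delta - 1)^-1 * y `^ (1 - delta).
have dq (y : R) : 0 < y -> is_derive y 1 q (g y - y `^ (- delta)).
  move=> y0.
  have := is_deriveD (dF y0) (is_deriveZ (delta - 1)^-1 (is_derive1_powR (1 - delta) y0)).
  rewrite (_ : 1 - delta - 1 = - delta); last by ring.
  rewrite (_ : (delta - 1)^-1 *: _ = - y `^ (- delta))//.
  rewrite -[LHS]/(_ * _); field; rewrite gt_eqF//.
have : q x <= q 1.
  apply: (@ler0_derive1_le_cc R q 1 x) => //; rewrite ?in_itv/= ?lexx ?(ltW x1)//.
  - move=> z; rewrite in_itv/= => /andP[z1 _].
    by case: (dq z (lt_trans ltr01 z1)).
  - move=> z; rewrite in_itv/= => /andP[z1 _]; rewrite derive1E.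
    case: (dq z (lt_trans ltr01 z1)) => _ ->.
    rewrite subr_le0; apply: (mathieu_g_le gamma0 alpha0 deltaE delta0).
    exact: lt_trans z1.
  - apply: derivable_within_continuous => z; rewrite in_itv/= => /andP[z1 _].
    by case: (dq z (lt_le_trans ltr01 z1)).
rewrite /q powR1 mulr1; apply: le_trans; rewrite lerDl mulr_ge0// ?invr_ge0 ?(ltW d1)//.
exact: powR_ge0.
Qed.

Definition mathieu_integral := sup (range F).

Let F_ub : has_ubound (range F).
Proof.
by exists (F 1 + (delta - 1)^-1) => _ [x _ <-]; exact: primitive_mathieu_g_le.
Qed.

Lemma primitive_mathieu_g_cvg : F x @[x --> +oo] --> mathieu_integral.
Proof. exact: nondecreasing_cvgr. Qed.

Lemma primitive_mathieu_g_le_integral x : F x <= mathieu_integral.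
Proof. by apply: ub_le_sup => //; exists x. Qed.

Let X := (gamma + 1) / alpha.
Let Y := mu + 1 - (gamma + 1) / alpha.
Let b (s : R) := s `^ (X - 1) * (1 - s) `^ (Y - 1).
Let psi (s : R) := (s / (1 - s)) `^ alpha^-1.

(** The change of variables [x = psi s], i.e. [s = x^alpha / (1 + x^alpha)]: the
    Beta integrand is the derivative of [alpha * F (psi s)]. *)
Lemma is_derive_beta_primitive (s : R) : 0 < s -> s < 1 ->
  is_derive s 1 (fun s => alpha * F (psi s)) (b s).
Proof.
move=> s0 s1; have v0 : 0 < 1 - s by rewrite subr_gt0.
have r0 : 0 < s / (1 - s) by rewrite divr_gt0.
have psi0 : 0 < psi s by rewrite powR_gt0.
have d1 : is_derive s 1 (fun s => 1 - s) (-1).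
  rewrite -[X in is_derive _ _ _ X]add0r.
  exact: (is_deriveB (is_derive_cst (1 : R) s 1) (is_derive_id s 1)).
have d2 : is_derive s 1 (fun s => s / (1 - s)) ((1 - s) ^- 2).
  have d1V := @is_deriveV R (fun s => 1 - s) s (-1) 1 (lt0r_neq0 v0) d1.
  apply: (is_derive_eq (is_deriveM (is_derive_id s 1) d1V)).
  rewrite -![_ *: _]/(_ * _) /=; field; exact: lt0r_neq0.
have d3 : is_derive s 1 psi (alpha^-1 * (s / (1 - s)) `^ (alpha^-1 - 1) * (1 - s) ^- 2).
  exact: (@is_derive1_comp R (fun y => y `^ alpha^-1) (fun s => s / (1 - s)) s _ _
    (is_derive1_powR alpha^-1 r0) d2).
have d4 := is_derive1_comp (dF psi0) d3.
apply: (is_derive_eq (is_deriveZ alpha d4)).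
rewrite -![_ *: _]/(_ * _) /g /mathieu_g /b.
have -> : psi s `^ alpha + 1 = (1 - s)^-1.
  rewrite /psi -powRrM mulVf ?gt_eqF// powRr1 ?ltW//; field; exact: lt0r_neq0.
rewrite /psi -powRrM.
(* on positive numbers every factor is an exponential, so exponents just add up *)
have powE (x a : R) : 0 < x -> x `^ a = expR (a * ln x).
  by move=> x0; rewrite /powR gt_eqF.
have vE : 1 - s = expR (ln (1 - s)) by rewrite lnK.
have sq : (1 - s) ^- 2 = expR (- (2 * ln (1 - s))).
  by rewrite expRN mulrC expRM_natr -vE.
rewrite sq !powE ?invr_gt0//.
rewrite lnM ?posrE ?invr_gt0// lnV ?posrE//.
set A := ln s; set B := ln (1 - s).
rewrite -expRD.
transitivity (alpha * alpha^-1 * (expR (alpha^-1 * gamma * (A - B)) * expR ((- mu - 1) * - B) *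
   (expR ((alpha^-1 - 1) * (A - B)) * expR (- (2 * B))))); first by rewrite expRD; ring.
rewrite divff ?gt_eqF// mul1r -!expRD; congr expR.
by rewrite /X /Y; field; rewrite gt_eqF.
Qed.

Lemma within_continuous_beta (p q : R) : 0 < p -> q < 1 ->
  {within `[p, q], continuous b}.
Proof.
move=> p0 q1; apply: derivable_within_continuous => s.
rewrite in_itv/= => /andP[ps sq].
have s0 := lt_le_trans p0 ps; have v0 : 0 < 1 - s by rewrite subr_gt0 (le_lt_trans sq).
have d1 : is_derive s 1 (fun s => 1 - s) (-1).
  rewrite -[X in is_derive _ _ _ X]add0r.
  exact: (is_deriveB (is_derive_cst (1 : R) s 1) (is_derive_id s 1)).
have d2 := @is_derive1_comp R (fun y => y `^ (Y - 1)) (fun s => 1 - s) s _ _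
    (is_derive1_powR (Y - 1) v0) d1.
by case: (is_deriveM (is_derive1_powR (X - 1) s0) d2).
Qed.

(* [n.+3] makes every interval [[cut n, 1 - cut n]] nondegenerate *)
Let cut n : R := n.+3%:R^-1.

Let cut_gt0 n : 0 < cut n. Proof. by rewrite invr_gt0. Qed.

Let cut_lt n : cut n < 1 - cut n.
Proof.
have : cut n <= 3^-1 by rewrite lef_pV2 ?posrE// ler_nat.
lra.
Qed.

Let cut_homo m n : (m <= n)%N -> cut n <= cut m.
Proof. by move=> mn; rewrite lef_pV2 ?posrE// ler_nat !ltnS. Qed.

Let cut_bigcup : \bigcup_n `[cut n, 1 - cut n]%classic = `]0, 1[%classic.
Proof.
apply/seteqP; split => s /=.
  move=> [n _] /=; rewrite !in_itv/= => /andP[cs sc].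
  by have := cut_gt0 n; lra.
rewrite in_itv/= => /andP[s0 s1].
pose e := Num.min s (1 - s).
have e0 : 0 < e by rewrite lt_min s0 subr_gt0.
have [N eN] : exists N, cut N <= e.
  near \oo => N; exists N.
  rewrite -[e]invrK lef_pV2 ?posrE ?invr_gt0// (@le_trans _ _ N%:R)//.
    by near: N; apply: cvgry_ge; exact: cvgr_idn.
  by rewrite ler_nat -addn3 leq_addr.
exists N => //=; rewrite in_itv/=.
by move: eN; rewrite le_min => /andP[]; lra.
Unshelve. all: by end_near. Qed.

Let cut_FTC n : (\int[@lebesgue_measure R]_(s in `[cut n, (1 - cut n)%R]) (b s)%:E =
  (alpha * F (psi (1 - cut n)) - alpha * F (psi (cut n)))%:E)%E.
Proof.
have c0 := cut_gt0 n; have cc := cut_lt n.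
have G (s : R) : 0 < s -> s < 1 -> is_derive s 1 (fun s => alpha * F (psi s)) (b s).
  exact: is_derive_beta_primitive.
rewrite EFinB; apply: (@continuous_FTC2 R b (fun s => alpha * F (psi s)) _ _ cc).
- by apply: within_continuous_beta => //; lra.
- split.
  + move=> s; rewrite in_itv/= => /andP[cs sc].
    by case: (G s) => //; lra.
  + by apply: cvg_at_right_filter; apply: is_derive_continuous (G _ _ _); lra.
  + by apply: cvg_at_left_filter; apply: is_derive_continuous (G _ _ _); lra.
- move=> s; rewrite in_itv/= => /andP[cs sc].
  by rewrite derive1E; case: (G s) => //; lra.
Qed.

Let root n : R := n.+2%:R `^ alpha^-1.

Let root_cvgy : root n @[n --> \oo] --> +oo.
Proof.
have n2 : (n.+2%:R : R) @[n --> \oo] --> +oo.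
  apply/cvgryPge => A; near=> n; rewrite (@le_trans _ _ n%:R)//.
    by near: n; apply: cvgry_ge; exact: cvgr_idn.
  by rewrite ler_nat -addn2 leq_addr.
have a0 : 0 < alpha^-1 by rewrite invr_gt0.
exact: (cvg_comp _ _ n2 (powR_cvgy a0)).
Unshelve. all: by end_near. Qed.

Let odds_cut n : cut n / (1 - cut n) = n.+2%:R^-1 /\
  (1 - cut n) / (1 - (1 - cut n)) = n.+2%:R.
Proof.
rewrite /cut -(natr1 n.+2); have : 0 < n.+2%:R :> R by [].
by move: (n.+2%:R) => K K0; split; field; apply/andP; split; apply: lt0r_neq0; lra.
Qed.

Let psi_right n : psi (1 - cut n) = root n.
Proof.
rewrite /psi /root; congr (_ `^ _).
exact: (odds_cut n).2.
Qed.

Let psi_left n : psi (cut n) = (root n)^-1.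
Proof.
rewrite /root -powRN -mulN1r powRrM powR_inv1// /psi; congr (_ `^ _).
exact: (odds_cut n).1.
Qed.

Let cut_FTC_cvg : (alpha * F (psi (1 - cut n)) - alpha * F (psi (cut n)))%:E
  @[n --> \oo] --> (alpha * mathieu_integral)%:E.
Proof.
apply: cvg_EFin; first by near=> n.
rewrite -[X in _ --> X]subr0 -[X in _ --> _ - X](mulr0 alpha); apply: cvgB.
  apply: cvgM; first exact: cvg_cst.
  under eq_fun do rewrite psi_right.
  exact: (cvg_comp _ _ root_cvgy primitive_mathieu_g_cvg).
apply: cvgM; first exact: cvg_cst.
under eq_fun do rewrite psi_left.
have root_inv : (root n)^-1 @[n --> \oo] --> (0 : R).
  by apply/gtr0_cvgV0 => //; near=> n; rewrite powR_gt0.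
exact: (cvg_comp _ _ root_inv (primitive_cvg0 within_continuous_mathieu_g)).
Unshelve. all: by end_near. Qed.

(** The Beta integrand may be singular at both ends of [[0, 1]], so the
    fundamental theorem is applied on the segments [[cut n, 1 - cut n]], and
    monotone convergence gives the integral on their union. *)
Lemma euler_beta_mathieu_integral : euler_beta X Y = alpha * mathieu_integral.
Proof.
rewrite /euler_beta /Rintegral -cut_bigcup.
have : (\int[@lebesgue_measure R]_(s in `[cut n, (1 - cut n)%R]) (b s)%:E)%E @[n --> \oo]
  --> (\int[@lebesgue_measure R]_(s in \bigcup_n `[cut n, (1 - cut n)%R]%classic) (b s)%:E)%E.
  apply: ge0_nondecreasing_set_cvg_integral.
  - move=> m n mn; apply/subsetPset => s /=; rewrite !in_itv/= => /andP[h1 h2].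
    by have := cut_homo mn; lra.
  - by move=> n; exact: measurable_itv.
  - move=> n; apply/measurable_EFinP.
    apply: subspace_continuous_measurable_fun; first exact: measurable_itv.
    by apply: within_continuous_beta; have := cut_gt0 n; lra.
  - by move=> n s _; rewrite lee_fin mulr_ge0// powR_ge0.
under eq_fun do rewrite cut_FTC.
by move=> /cvg_unique /(_ cut_FTC_cvg) ->.
Qed.

End mathieu_integral.

(** * Homogeneity and conclusion *)

Lemma unif_littleo1_inv (R : realType) (K : R -> R -> R) (a : R) :
  (forall e, 0 < e -> exists2 d, 0 < d &
     forall u h, 0 <= u -> u <= a -> 0 < h -> h <= d -> `|K u h| <= e) ->
  unif_littleo1 `[0, a] (fun t u => K u t^-1).
Proof.
move=> Ksmall e /Ksmall[d d0 Kd]; near=> t => u /=.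
rewrite in_itv/= => /andP[u0 ua].
have t0 : 0 < t by near: t; exact: nbhs_pinfty_gt (num_real _).
have td : d^-1 <= t by near: t; exact: nbhs_pinfty_ge (num_real _).
by apply: Kd => //; rewrite ?invr_gt0// -[d]invrK lef_pV2 ?posrE ?invr_gt0.
Unshelve. all: by end_near. Qed.

Lemma unif_littleo1_cvg (R : realType) (A : set R) (l : R -> R -> R) (u : R) :
  unif_littleo1 A l -> A u -> l t u @[t --> +oo] --> 0.
Proof.
move=> lA Au; apply/cvgr0Pnorm_le => e /lA; apply: filterS => t; exact.
Qed.

Section scaling.
Variables (R : realType) (gamma alpha mu delta : R).
Hypothesis deltaE : delta = alpha * (mu + 1) - gamma.
Variables (t u : R).
Hypotheses (t0 : 0 < t) (u0 : 0 <= u).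
Let g := mathieu_g gamma alpha mu.

Lemma mathieu_term_scaling k :
  mathieu_term t u gamma alpha mu k = t `^ (- delta) * (2 * g ((k%:R + u) * t^-1)).
Proof.
pose y := (k%:R + u) * t^-1.
have y0 : 0 <= y by rewrite mulr_ge0 ?addr_ge0// invr_ge0 ltW.
have kE : k%:R + u = t * y by rewrite /y mulrC divfK// gt_eqF.
have t0' := ltW t0.
rewrite /mathieu_term -/y kE; move: {kE} y y0 => y y0; rewrite !powRM//.
rewrite (_ : t `^ alpha * y `^ alpha + t `^ alpha = t `^ alpha * (y `^ alpha + 1)); last by ring.
rewrite powRM ?addr_ge0 ?powR_ge0// -powRrM.
rewrite (_ : - delta = gamma + - (alpha * (mu + 1))); last by rewrite deltaE; ring.
have gE : g y = y `^ gamma * ((y `^ alpha + 1) `^ (mu + 1))^-1.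
  by rewrite -powRN /g /mathieu_g; congr (_ * _ `^ _); ring.
by rewrite gE (gt0_powRD gamma _ t0) powRN invfM; ring.
Qed.

Lemma alt_mathieu_psum_scaling :
  alt_mathieu_psum t u gamma alpha mu =
  (fun n => t `^ (- delta) * alternating_sum g u t^-1 n).
Proof.
apply/funext => n; rewrite /alt_mathieu_psum /alternating_sum mulr_sumr.
by apply: eq_bigr => k _; rewrite mathieu_term_scaling mulrCA.
Qed.

Lemma mathieu_psum_scaling :
  mathieu_psum t u gamma alpha mu =
  (fun n => t `^ (- delta) * sample_sum g u t^-1 n).
Proof.
apply/funext => n; rewrite /mathieu_psum /sample_sum mulr_sumr.
by apply: eq_bigr => k _; rewrite mathieu_term_scaling.
Qed.

End scaling.

Theorem corollary4p2 (R : realType) (gamma alpha mu delta : R)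
    (hgamma : 0 <= gamma) (halpha : 0 < alpha)
    (hdelta : delta = alpha * (mu + 1) - gamma) (hdelta0 : 0 < delta) :
  let g := mathieu_g gamma alpha mu in
  let V := ray_total_variation 0 g in
  [/\ ray_bounded_variation 0 g,
      gamma = 0 -> V = 1%:E,
      0 < gamma ->
        V = (2 * (gamma / delta) `^ (gamma / alpha)
               * (gamma / delta + 1) `^ (- mu - 1))%:E,
      exists l : R -> R -> R,
        [/\ forall u t : R, 0 <= u -> 0 < t ->
              [/\ cvgn (alt_mathieu_psum t u gamma alpha mu),
                  alt_mathieu t u gamma alpha mu =
                    (g 0 + l t u) / t `^ (alpha * (mu + 1) - gamma) &
                  (`|l t u|%:E <= V)%E],
            forall u : R, 0 <= u -> l t u @[t --> +oo] --> 0 &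
            forall a : R, 0 < a -> unif_littleo1 `[0, a] l] &
      1 < delta ->
      exists L : R -> R -> R,
        [/\ forall u t : R, 0 <= u -> 0 < t ->
              [/\ cvgn (mathieu_psum t u gamma alpha mu),
                  mathieu t u gamma alpha mu =
                    2 / alpha * euler_beta ((gamma + 1) / alpha)
                                  (mu + 1 - (gamma + 1) / alpha)
                      / t `^ (alpha * (mu + 1) - gamma - 1)
                    - ((1 + 2 * u) * g 0 - L t u)
                      / t `^ (alpha * (mu + 1) - gamma) &
                  (`|L t u|%:E <= (1 + 2 * u)%:E * V)%E],
            forall u : R, 0 <= u -> L t u @[t --> +oo] --> 0 &
            forall a : R, 0 < a -> unif_littleo1 `[0, a] L]].
Proof.
move=> g V.
pose m := mathieu_mode gamma alpha delta.
have m0 : 0 <= m := mathieu_mode_ge0 _ _ _.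
have incr := mathieu_g_incr hgamma halpha hdelta hdelta0.
have decr := mathieu_g_decr hgamma halpha hdelta hdelta0.
have g_ge0 x : 0 <= x -> 0 <= g x by move=> _; exact: mathieu_g_ge0.
have gy : g x @[x --> +oo] --> 0 := mathieu_g_cvg0 hgamma halpha hdelta hdelta0.
have gz : g x @[x --> 0^'+] --> g 0 := mathieu_g_near0 hgamma halpha.
pose v := 2 * g m - g 0.
have VE : V = v%:E := unimodal_ray_total_variation m0 incr decr g_ge0 gy.
have gW : variation_bound g (unimodal_variation g m) := unimodal_variation_bound incr decr.
have W0 := unimodal_variation0 g m0.
have Wz := unimodal_variation_near0 m0 gz.
have Wy := @unimodal_variation_neary R g m gy.
have Wv x : 0 <= x -> unimodal_variation g m x <= v.
  by move=> x0; exact: unimodal_variation_le.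
have dg (x : R) : 0 < x -> is_derive x 1 g (mathieu_g' gamma alpha mu delta x).
  exact: is_derive_mathieu_g.
have cg' (x : R) : 0 < x -> {for x, continuous (mathieu_g' gamma alpha mu delta)}.
  exact: continuous_mathieu_g'.
rewrite -hdelta; split.
- exact: (unimodal_ray_bounded_variation m0 incr decr g_ge0).
- move=> gamma0.
  have mE : m = 0.
    by rewrite /m /mathieu_mode gamma0 mul0r powR0// invr_neq0// lt0r_neq0.
  have g0E : g 0 = 1.
    by rewrite /g /mathieu_g gamma0 powRr0 powR0 ?lt0r_neq0// add0r powR1 mulr1.
  by rewrite VE /v mE g0E; congr (_%:E); ring.
- move=> gamma0; rewrite VE /v; congr (_%:E).
  have -> : g 0 = 0 by rewrite /g /mathieu_g powR0 ?gt_eqF// mul0r.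
  rewrite /g /mathieu_g mathieu_mode_powR// /m /mathieu_mode -powRrM subr0 mulrA.
  by rewrite [alpha^-1 * gamma]mulrC.
- exists (fun t u => limn (alternating_sum g u t^-1) - g 0).
  have lo a : 0 <= a -> unif_littleo1 `[0, a]
      (fun t u => limn (alternating_sum g u t^-1) - g 0).
    move=> a0; apply: (@unif_littleo1_inv _ (fun u h => limn (alternating_sum g u h) - g 0)).
    by move=> e e0; exact: alternating_remainder_small Wz Wy dg cg' gy _ _ a0 e0.
  split=> [u t u0 t0|u u0|a a0]; last exact/lo/ltW.
    have h0 : 0 < t^-1 by rewrite invr_gt0.
    have cS := is_cvg_alternating_sum u0 h0 gW Wv gy.
    rewrite /alt_mathieu (alt_mathieu_psum_scaling hdelta)//.
    have cM : t `^ (- delta) * alternating_sum g u t^-1 n @[n --> \oo] -->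
        t `^ (- delta) * limn (alternating_sum g u t^-1).
      by apply: cvgM; [exact: cvg_cst|exact: cS].
    split; first by apply/cvg_ex; eexists; exact: cM.
      by rewrite (cvg_lim _ cM)// powRN addrC subrK mulrC.
    by rewrite VE lee_fin; exact: (alternating_remainder_le gW W0 Wv gy).
  by apply: unif_littleo1_cvg (lo u u0) _; rewrite /= in_itv/= u0 lexx.
- move=> delta1.
  pose I := mathieu_integral gamma alpha mu.
  have betaE := euler_beta_mathieu_integral hgamma halpha hdelta delta1.
  have cg := within_continuous_mathieu_g hgamma halpha hdelta.
  have dF (x : R) : 0 < x -> is_derive x 1 (primitive g) (g x).
    exact: (is_derive_primitive cg).
  have F0 : primitive g 0 = 0 by exact: primitive0.
  have Fz : primitive g x @[x --> 0^'+] --> 0.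
    exact: cvg_at_right_filter (primitive_cvg0 cg).
  have Fy : primitive g x @[x --> +oo] --> I.
    exact: (primitive_mathieu_g_cvg hgamma halpha hdelta delta1).
  have FI x : 0 < x -> primitive g x <= I.
    by move=> _; exact: (primitive_mathieu_g_le_integral hgamma halpha hdelta delta1).
  pose K u h := limn (sample_sum g u h) - 2 / h * I + (1 + 2 * u) * g 0.
  exists (fun t u => K u t^-1).
  have lo a : 0 <= a -> unif_littleo1 `[0, a] (fun t u => K u t^-1).
    move=> a0; apply: unif_littleo1_inv => e e0.
    exact: (midpoint_remainder_small gW W0 Wv Wz Wy dg cg' g_ge0 dF F0 Fz Fy FI a0 e0).
  split=> [u t u0 t0|u u0|a a0]; last exact/lo/ltW.
    have h0 : 0 < t^-1 by rewrite invr_gt0.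
    have cS := is_cvg_sample_sum gW Wv g_ge0 dF FI u0 h0.
    rewrite /mathieu (mathieu_psum_scaling hdelta)//.
    have cM : t `^ (- delta) * sample_sum g u t^-1 n @[n --> \oo] -->
        t `^ (- delta) * limn (sample_sum g u t^-1).
      by apply: cvgM; [exact: cvg_cst|exact: cS].
    split; first by apply/cvg_ex; eexists; exact: cM.
      rewrite (cvg_lim _ cM)// betaE -/I /K powRN invrK.
      have -> : t `^ (delta - 1) = t `^ delta / t.
        by rewrite gt0_powRD// powR_inv1// ltW.
      by field; rewrite !gt_eqF ?powR_gt0.
    rewrite VE -EFinM lee_fin.
    exact: (midpoint_remainder_le gW W0 Wv g_ge0 dF F0 Fz Fy FI u0 h0).
  by apply: unif_littleo1_cvg (lo u u0) _; rewrite /= in_itv/= u0 lexx.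
Qed.
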